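(* There exist absolute constants $c>0$ and $n_0$ such that for every $n\ge n_0$ and every $p$ with $10^{-6}\le p\le 1-10^{-6}$, if $G\sim G(n,p)$ then $$\mathbb{P}(G\text{ is even-non-decomposable})\le e^{-cn^2}.$$ In particular, for $G\sim G(n,1/2)$ the probability that $G$ is even-non-decomposable is $e^{-\Omega(n^2)}$.
   Context: $G(n,p)$ is the binomial random graph on $n$ labelled vertices in which each pair is an edge independently with probability $p$. A graph $H$ is even-decomposable if there is a sequence $V(H)=V_0\supset V_1\supset\cdots\supset V_k=\emptyset$ such that for each $0\le i\le k-1$, the induced subgraph $H[V_i]$ has an even number of edges and $V_i\setminus V_{i+1}$ is an independent set in $H$. A graph is even-non-decomposable if it has an even number of edges but is not even-decomposable. *)

(* Defs.v *)
From HB Require Import structures.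
From mathcomp Require Import all_boot all_order all_algebra.
From mathcomp Require Import boolp Rstruct.
From Stdlib Require Rdefinitions.
Set Implicit Arguments. Unset Strict Implicit. Unset Printing Implicit Defensive.
Import Order.TTheory GRing.Theory Num.Theory.

Definition pairs (n : nat) : {set {set 'I_n}} := [set e : {set 'I_n} | #|e| == 2].

Definition is_graph (n : nat) (E : {set {set 'I_n}}) : bool := E \subset pairs n.

Definition induced_edges (n : nat) (E : {set {set 'I_n}}) (V : {set 'I_n}) : nat :=
  #|[set e in E | e \subset V]|.

Definition independent (n : nat) (E : {set {set 'I_n}}) (S : {set 'I_n}) : bool :=
  [forall e in E, ~~ (e \subset S)].

Definition even_decomposable (n : nat) (E : {set {set 'I_n}}) : Prop :=
  exists (k : nat) (V : nat -> {set 'I_n}),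
    [/\ V 0%N = [set: 'I_n], V k = set0 &
        forall i, (i < k)%N ->
          [/\ V i.+1 \proper V i,
              ~~ odd (induced_edges E (V i)) &
              independent E (V i :\: V i.+1)]].

Definition even_non_decomposable (n : nat) (E : {set {set 'I_n}}) : Prop :=
  ~~ odd #|E| /\ ~ even_decomposable E.

Local Open Scope ring_scope.

Definition Gnp_prob (n : nat) (p : Rdefinitions.R) (P : {set {set 'I_n}} -> Prop) : Rdefinitions.R :=
  \sum_(E : {set {set 'I_n}} | is_graph E && `[< P E >])
     p ^+ #|E| * (1 - p) ^+ (#|pairs n| - #|E|).

(* Main.v *)
Require Import Defs.
From HB Require Import structures.
From mathcomp Require Import all_boot all_order all_algebra.
From mathcomp Require Import boolp Rstruct.
From mathcomp Require Import zify lra.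
From Stdlib Require Rtrigo_def Exp_prop Rpower.
Import Order.TTheory GRing.Theory Num.Theory.

(** Deleting a vertex of even degree, or two non-adjacent vertices whose degrees
    have the same parity, keeps the number of edges even; hence inside any vertex
    set [A] one can delete vertices until a clique of [A] is left, and one stubborn
    vertex can always be deleted at the expense of an induced [2K_2].

    Suppose every set of at least [s] vertices contains an induced matching with 6
    edges, and [13 s <= n]. Greedily, all vertices but a set [L] with [|L| < s] are
    covered by disjoint such matchings [M_1, ..., M_t], and [t >= s]. Add at most
    one vertex of [L] to each [M_j]. In such an enlarged matching, and in any of
    its subsets, cliques have at most 3 vertices; these are deleted using
    the three copies of [2K_2] in the still intact [M_{j+1}], whose remains are
    treated next. The last clique has at most 3 vertices and an even number of
    edges, so at most one vertex.

    A set of [144 N] vertices contains [N^2] 12-subsets no two of which share two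
    vertices, so it has no induced 6-edge matching with probability at most
    [(1 - r^66)^(N^2)]; a union bound over the [2^n] vertex sets concludes. *)

(** * Edge parities and deletions that keep the edge count even *)

Section Decomposition.
Variables (n : nat) (E : {set {set 'I_n}}).
Hypothesis graphE : is_graph E.
Implicit Types (V W X A C L S : {set 'I_n}) (u v w x y : 'I_n).

Definition adj v w := [set v; w] \in E.
Definition edge_parity V := odd (induced_edges E V).
(* For [v] in [V] this is the parity of the degree of [v] in the subgraph induced by [V]. *)
Definition degree_parity V v := edge_parity V (+) edge_parity (V :\ v).

Lemma adjC v w : adj v w = adj w v.
Proof. by rewrite /adj setUC. Qed.

Lemma edge_card (e : {set 'I_n}) : e \in E -> #|e| = 2.
Proof. by move/(subsetP graphE); rewrite inE => /eqP. Qed.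

(** Inclusion-exclusion over the edges avoiding [v] and those avoiding [w]: only [[set v; w]] can
    belong to neither family. *)
Lemma induced_edges_pair V v w : v != w -> v \in V -> w \in V ->
  induced_edges E V + induced_edges E (V :\ w :\ v) =
  induced_edges E (V :\ v) + induced_edges E (V :\ w) + adj v w.
Proof.
move=> neq vV wV; rewrite /induced_edges.
set A := [set e in E | e \subset V :\ v]; set B := [set e in E | e \subset V :\ w].
have -> : [set e in E | e \subset V :\ w :\ v] = A :&: B.
  apply/setP => e; rewrite !inE !subsetD1; case: (e \in E) => //=.
  by case: (e \subset V) => //=; rewrite andbC.
have AB : A :|: B = [set e in E | e \subset V] :\: [set [set v; w]].
  apply/setP => e; rewrite !inE !subsetD1; case: (boolP (e \in E)) => [eE|_] /=;
    last by rewrite andbF.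
  case: (boolP (e \subset V)) => [eV|_] /=; last by rewrite andbF.
  rewrite andbT -negb_and; congr negb; apply/andP/eqP => [[ve we]|->].
    apply/esym/eqP; rewrite eqEcard (edge_card _ eE) cards2 neq leqnn andbT.
    by apply/subsetP => z; rewrite !inE => /orP[/eqP->|/eqP->].
  by rewrite !inE !eqxx orbT.
rewrite -[#|A| + #|B|]cardsUI AB [in LHS](cardsD1 [set v; w]) !inE /adj.
rewrite subUset !sub1set vV wV !andbT. by rewrite -addnA addnC.
Qed.

Lemma degree_parityD1 V v w : v != w -> v \in V -> w \in V ->
  degree_parity (V :\ w) v = degree_parity V v (+) adj v w.
Proof.
move=> neq vV wV; have /(congr1 odd) := induced_edges_pair V v w neq vV wV.
rewrite !oddD /degree_parity /edge_parity.
by do 4![case: (odd (induced_edges _ _))]; case: adj.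
Qed.

Lemma edge_parityD1 V v : edge_parity (V :\ v) = edge_parity V (+) degree_parity V v.
Proof. by rewrite /degree_parity addbA addbb. Qed.

(** Steps may be trivial and evenness is asked only of the sets after the first, so that chains
    concatenate freely. Strict inclusion is restored in [reach_decomposable]. *)
Inductive reach : {set 'I_n} -> {set 'I_n} -> Prop :=
| reach_refl V : reach V V
| reach_step V W X : W \subset V -> independent E (V :\: W) ->
    ~~ edge_parity W -> reach W X -> reach V X.

Lemma reach_trans V W X : reach V W -> reach W X -> reach V X.
Proof. by elim=> // ? ? ? s i p _ IH /IH; apply: reach_step. Qed.

Lemma reach_sub V W : reach V W -> W \subset V.
Proof. by elim=> // ? ? ? s _ _ _ IH; apply: subset_trans IH s. Qed.

Lemma reach_even V W : reach V W -> ~~ edge_parity V -> ~~ edge_parity W.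
Proof. by elim=> // ? ? ? _ _ p _ IH _; apply: IH. Qed.

Lemma independent1 v : independent E [set v].
Proof.
apply/forall_inP => e /edge_card e2; apply/negP => /subset_leq_card.
by rewrite e2 cards1.
Qed.

Lemma independent2 v w : ~~ adj v w -> independent E [set v; w].
Proof.
move=> nadj; apply/forall_inP => e eE; apply: contra nadj => sub.
rewrite /adj -(_ : e = [set v; w]) //; apply/eqP.
by rewrite eqEcard sub (edge_card _ eE) cards2; case: eqP.
Qed.

Lemma independentS V W : W \subset V -> independent E V -> independent E W.
Proof.
move=> WV /forall_inP iV; apply/forall_inP => e /iV.
by apply: contra => eW; apply: subset_trans eW WV.
Qed.

Lemma reach1 V v : ~~ edge_parity V -> ~~ degree_parity V v -> reach V (V :\ v).
Proof.
move=> eV dv; apply: reach_step (subD1set _ _) _ _ (reach_refl _).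
  apply: independentS (independent1 v).
  by apply/subsetP => x; rewrite !inE; case: eqP => //= _ /andP[/negPf->].
by rewrite edge_parityD1 (negPf eV) (negPf dv).
Qed.

(** Without an edge between [v] and [w], the edge count drops by the sum of their degrees, which is
    even. *)
Lemma reach2 V v w : v != w -> v \in V -> w \in V -> ~~ edge_parity V ->
  ~~ adj v w -> degree_parity V v = degree_parity V w -> reach V (V :\ v :\ w).
Proof.
move=> neq vV wV eV nvw dvw.
apply: reach_step (subset_trans (subD1set _ _) (subD1set _ _)) _ _ (reach_refl _).
  apply: independentS (independent2 _ _ nvw).
  by apply/subsetP => x; rewrite !inE; do 2![case: eqP => //= _] => /andP[/negPf->].
rewrite !edge_parityD1 degree_parityD1 1?eq_sym //.
by rewrite dvw (negPf eV) adjC (negPf nvw) addbF addFb addbb.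
Qed.

Lemma reach_decomposable : reach [set: 'I_n] set0 -> ~~ odd #|E| ->
  even_decomposable E.
Proof.
move=> r evE.
suff: forall V X, reach V X -> ~~ edge_parity V ->
    exists k (U : nat -> {set 'I_n}), [/\ U 0 = V, U k = X &
      forall i, (i < k)%N -> [/\ U i.+1 \proper U i, ~~ odd (induced_edges E (U i)) &
        independent E (U i :\: U i.+1)]].
  apply=> //; rewrite /edge_parity /induced_edges.
  by rewrite (_ : [set e in E | _] = E) //; apply/setP => e; rewrite !inE subsetT andbT.
move=> V X; elim=> {V X}; first by move=> V _; exists 0, (fun=> V).
move=> V W X WV iW eW _ IH eV; have [k [U [U0 Uk US]]] := IH eW.
(* A trivial step is skipped, since the chain must decrease strictly. *)
have [VW|nVW] := eqVneq V W; first by rewrite VW; exists k, U.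
exists k.+1, (fun i => if i is j.+1 then U j else V); split=> // -[|i] ik; last exact: US.
by rewrite U0; split=> //; rewrite properEneq eq_sym nVW.
Qed.

(** * Removing one given vertex at the expense of a small set *)

Definition clearable V u S := ~~ edge_parity V ->
  exists W, [/\ reach V W, u \notin W & V :\: S \subset W].

Lemma clearable_out V u S : u \notin V -> clearable V u S.
Proof. by move=> uV _; exists V; split; [apply: reach_refl | | apply: subsetDl]. Qed.

Lemma clearable_self V u S : u \in S -> ~~ degree_parity V u -> clearable V u S.
Proof.
move=> uS du eV; exists (V :\ u); split; first exact: reach1.
  by rewrite !inE eqxx.
by apply: setDS; rewrite sub1set.
Qed.

Lemma clearable_step1 V u S w : w \in S -> ~~ degree_parity V w ->
  clearable (V :\ w) u S -> clearable V u S.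
Proof.
move=> wS dw C eV; have r := reach1 _ _ eV dw.
have [W [rW uW sW]] := C (reach_even _ _ r eV).
exists W; split=> //; first exact: reach_trans rW.
by apply: subset_trans sW; rewrite setDDl (setUidPr _) // sub1set.
Qed.

Lemma clearable_step2 V u S v w : v \in S -> w \in S -> v != w ->
  v \in V -> w \in V -> ~~ adj v w -> degree_parity V v = degree_parity V w ->
  clearable (V :\ v :\ w) u S -> clearable V u S.
Proof.
move=> vS wS neq vV wV nvw dvw C eV; have r := reach2 _ _ _ neq vV wV eV nvw dvw.
have [W [rW uW sW]] := C (reach_even _ _ r eV).
exists W; split=> //; first exact: reach_trans rW.
apply: subset_trans sW; rewrite !setDDl.
by rewrite [[set w] :|: S](setUidPr _) ?(setUidPr _) // sub1set.
Qed.

(* Whatever the parities are, at most three of [x1, y1, x2, y2] have to be deleted along with [u]. *)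
Lemma clearable_vertex V u x1 y1 x2 y2 :
  uniq [:: u; x1; y1; x2; y2] -> {subset [:: x1; y1; x2; y2] <= V} ->
  adj x1 y1 -> adj x2 y2 -> ~~ adj x1 x2 -> ~~ adj y1 x2 ->
  clearable V u [set z in [:: u; x1; y1; x2; y2]].
Proof.
move=> un sub a11 a22 n12 n21; set S := [set z in _].
have [uV|] := boolP (u \in V); last exact: clearable_out.
have [du|du] := boolP (degree_parity V u); last first.
  by apply: clearable_self du; rewrite !inE eqxx.
have inS w : w \in [:: x1; y1; x2; y2] -> [/\ w \in S, w \in V & u != w].
  move=> wB; split; [by rewrite inE inE wB orbT | exact: sub |].
  by apply: contraTneq wB => <-; move: un => /= /andP[].
have uS : u \in S by rewrite !inE eqxx.
(* Here [u] has odd degree. A neighbour [w] of even degree is deleted first, which makes the degree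
   of [u] even; a non-neighbour of odd degree is deleted together with [u]. *)
have direct w : w \in [:: x1; y1; x2; y2] -> degree_parity V w != adj u w ->
    clearable V u S.
  move=> /inS[wS wV uw].
  case dw: (degree_parity V w); case auw: (adj u w) => // _.
    apply: (clearable_step2 _ _ _ w u wS uS _ wV uV); rewrite 1?eq_sym ?dw ?du //.
      by rewrite adjC auw.
    by apply: clearable_out; rewrite !inE eqxx.
  apply: (clearable_step1 _ _ _ w); rewrite ?dw //.
  by apply: clearable_self; rewrite // degree_parityD1 // du auw.
(* Now [y] has even degree and is not adjacent to [u]. Deleting it flips the parity of [x] but not
   that of [u], so the argument of [direct] applies to [x]. *)
have edge x y : x \in [:: x1; y1; x2; y2] -> y \in [:: x1; y1; x2; y2] ->
    x != y -> adj x y -> degree_parity V x = adj u x -> degree_parity V y = adj u y ->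
    ~~ adj u y -> clearable V u S.
  move=> /inS[xS xV ux] /inS[yS yV uy] xy axy dx dy nuy.
  apply: (clearable_step1 _ _ _ y); rewrite ?dy //.
  have du' : degree_parity (V :\ y) u by rewrite degree_parityD1 // du (negPf nuy).
  have dx' : degree_parity (V :\ y) x = ~~ adj u x.
    by rewrite degree_parityD1 // dx axy addbT.
  have [xV' uV'] : x \in V :\ y /\ u \in V :\ y by rewrite !inE xV uV xy uy.
  case aux: (adj u x).
    apply: (clearable_step1 _ _ _ x); rewrite ?dx' ?aux //.
    by apply: clearable_self; rewrite // degree_parityD1 // du' aux.
  apply: (clearable_step2 _ _ _ x u xS uS _ xV' uV'); rewrite ?dx' ?aux ?du' 1?eq_sym //.
    by rewrite adjC aux.
  by apply: clearable_out; rewrite !inE eqxx.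
have [B1 B2 B3 B4]: [/\ x1 \in [:: x1; y1; x2; y2], y1 \in [:: x1; y1; x2; y2],
    x2 \in [:: x1; y1; x2; y2] & y2 \in [:: x1; y1; x2; y2]].
  by rewrite !inE !eqxx ?orbT.
case: (eqVneq (degree_parity V x1) (adj u x1)) => [d1|]; last exact: direct B1.
case: (eqVneq (degree_parity V y1) (adj u y1)) => [e1|]; last exact: direct B2.
case: (eqVneq (degree_parity V x2) (adj u x2)) => [d2|]; last exact: direct B3.
move: un; rewrite /= !inE !negb_or => /and5P[_ /and3P[xy1 x12 _] /andP[yx12 _] xy2 _].
have [ax1|nax1] := boolP (adj u x1); last first.
  by apply: (edge y1 x1 B2 B1); rewrite // 1?eq_sym // adjC.
have [ay1|nay1] := boolP (adj u y1); last by apply: (edge x1 y1 B1 B2).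
have [ax2|nax2] := boolP (adj u x2); last first.
  case: (eqVneq (degree_parity V y2) (adj u y2)) => [e2|]; last exact: direct B4.
  by apply: (edge y2 x2 B4 B3); rewrite // 1?eq_sym // adjC.
have [[[x1S x1V ux1] [y1S y1V uy1]] [x2S x2V ux2]] := (inS _ B1, inS _ B2, inS _ B3).
(* What remains: [x1], [y1], [x2] are neighbours of [u] of odd degree. Deleting [x1] and [x2]
   together makes [y1] even and leaves [u] odd; deleting [y1] then makes [u] even. *)
apply: (clearable_step2 _ _ _ x1 x2 x1S x2S x12 x1V x2V); rewrite // ?d1 ?d2 ?ax1 ?ax2 //.
have [y1V' uV'] : y1 \in V :\ x1 /\ u \in V :\ x1.
  by rewrite !inE y1V uV ux1 eq_sym xy1.
have [x2V' y1V''] : x2 \in V :\ x1 /\ y1 \in V :\ x1 :\ x2.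
  by rewrite !inE x2V y1V eq_sym x12 yx12 eq_sym xy1.
have uV'' : u \in V :\ x1 :\ x2 by rewrite !inE uV ux1 ux2.
apply: (clearable_step1 _ _ _ y1) => //.
  by rewrite !degree_parityD1 // 1?eq_sym // e1 ay1 adjC a11 (negPf n21).
by apply: clearable_self; rewrite // !degree_parityD1 // du ax1 ax2 ay1.
Qed.

(** * Reduction to cliques *)

Definition clique A := [forall v in A, forall w in A, (v != w) ==> adj v w].

Lemma cliqueP A : reflect {in A &, forall v w, v != w -> adj v w} (clique A).
Proof.
apply: (iffP forall_inP) => [c v w vA wA vw|c v vA].
  by move/forall_inP: (c v vA) => /(_ w wA); rewrite vw.
by apply/forall_inP => w wA; apply/implyP; apply: c.
Qed.

Lemma cliqueS V W : W \subset V -> clique V -> clique W.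
Proof.
move=> /subsetP WV /cliqueP c; apply/cliqueP => v w vW wW; exact: c (WV _ _) (WV _ _).
Qed.

(** Of two non-adjacent vertices of [V :&: A], either one has even degree and can go alone, or both
    have odd degree and can go together; repeat. *)
Lemma reach_clique V A : ~~ edge_parity V ->
  exists W, [/\ reach V W, V :\: A \subset W & clique (W :&: A)].
Proof.
have [m] := ubnP #|V|; elim: m V => // m IH V lt eV.
have [cl|] := boolP (clique (V :&: A)).
  by exists V; split=> //; [apply: reach_refl | apply: subsetDl].
rewrite negb_forall_in => /exists_inP[v]; rewrite inE => /andP[vV vA].
rewrite negb_forall_in => /exists_inP[w]; rewrite inE negb_imply => /andP[wV wA] /andP[vw nvw].
have step U : reach V U -> U \proper V -> V :\: A \subset U ->
    exists W, [/\ reach V W, V :\: A \subset W & clique (W :&: A)].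
  move=> rU UV sU; have [|W [rW sW cW]] := IH U _ (reach_even _ _ rU eV).
    by apply: leq_trans (proper_card UV) _.
  exists W; split=> //; first exact: reach_trans rW.
  apply: subset_trans sW; apply/subsetP => x; rewrite !inE => /andP[xA xV].
  by rewrite xA (subsetP sU) // inE xA.
have sub1 x : x \in A -> V :\: A \subset V :\ x by move=> xA; apply: setDS; rewrite sub1set.
have [dv|dv] := boolP (degree_parity V v); last first.
  by apply: step (reach1 _ _ eV dv) (properD1 vV) (sub1 _ vA).
have [dw|dw] := boolP (degree_parity V w); last first.
  by apply: step (reach1 _ _ eV dw) (properD1 wV) (sub1 _ wA).
apply: (step (V :\ v :\ w)); first by apply: reach2; rewrite ?dv ?dw.
  by apply: sub_proper_trans (subD1set _ _) (properD1 vV).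
by rewrite setDDl; apply: setDS; rewrite subUset !sub1set vA wA.
Qed.

(** Cliques on 2 and 3 vertices have 1 and 3 edges, so evenness leaves at most one vertex. *)
Lemma clique_reach0 V : ~~ edge_parity V -> clique V -> (#|V| < 4)%N -> reach V set0.
Proof.
move=> eV cl V3.
have p1 W : (#|W| < 2)%N -> edge_parity W = false.
  move=> W2; rewrite /edge_parity /induced_edges (_ : [set e in E | _] = set0) ?cards0 //.
  apply/setP => e; rewrite !inE; apply/andP => -[/edge_card e2 /subset_leq_card].
  by rewrite e2 leqNgt W2.
(* [degree_parityD1] for adjacent vertices, read as a recursion for the edge parity of a clique. *)
have pair W v w : clique W -> v \in W -> w \in W -> v != w -> edge_parity W =
    ~~ (edge_parity (W :\ v) (+) edge_parity (W :\ w) (+) edge_parity (W :\ w :\ v)).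
  move=> /cliqueP c vW wW vw; have := degree_parityD1 _ _ _ vw vW wW.
  rewrite /degree_parity c //; by do 4![case: (edge_parity _)].
have two W : (1 < #|W|)%N -> exists v w, [/\ v \in W, w \in W & v != w] /\
    [/\ #|W :\ v| = #|W|.-1, #|W :\ w| = #|W|.-1 & #|W :\ w :\ v| = #|W|.-2].
  move=> /card_gt1P[v [w [vW wW vw]]]; exists v, w; split; first by [].
  split.
  - by rewrite (cardsD1 v W) vW.
  - by rewrite (cardsD1 w W) wW.
  - by rewrite (cardsD1 w W) (cardsD1 v (W :\ w)) wW !inE vw vW.
have p2 W : #|W| = 2 -> clique W -> edge_parity W.
  move=> W2 c; have [v [w [[vW wW vw] [c1 c2 c3]]]] := two W (eq_ind_r (leq 2) (leqnn 2) W2).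
  by rewrite (pair W v w) // !p1 // ?c1 ?c2 ?c3 W2.
case V0: #|V| V3 => [|[|[|[|//]]]] _.
- by move/cards0_eq: V0 => ->; apply: reach_refl.
- have /eqP/cards1P[v Vv] := V0; have -> : set0 = V :\ v by rewrite Vv setDv.
  by apply: reach1 => //; rewrite /degree_parity !p1 // Vv ?setDv ?cards0 ?cards1.
- by case/negP: eV; apply: p2.
- case/negP: eV; have [v [w [[vW wW vw] [c1 c2 c3]]]] := two V (eq_ind_r (leq 2) (leqnSn 2) V0).
  have sub x : clique (V :\ x) by apply: cliqueS cl; apply: subD1set.
  rewrite (pair V v w) // (p2 (V :\ v)) ?c1 ?V0 // (p2 (V :\ w)) ?c2 ?V0 //.
  by rewrite p1 // c3 V0.
Qed.

(** * Induced matchings as a supply of [2K_2] *)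

(* The list [s] enumerates the edges one after the other: [s_0 s_1], [s_2 s_3], ... *)
Definition induced_matching (s : seq 'I_n) :=
  {in s &, forall x y, x != y -> adj x y = ((index x s)./2 == (index y s)./2)}.

(** Adjacent entries have indices with equal halves, and at most two indices share a half. *)
Lemma induced_matching_clique s A : induced_matching s -> {subset A <= s} ->
  clique A -> (#|A| <= 2)%N.
Proof.
move=> mat sub /cliqueP cl; rewrite leqNgt; apply/negP => /card_gt2P[x [y [z]]].
move=> [[xA yA zA] [xy yz zx]]; have [xs ys zs] := And3 (sub x xA) (sub y yA) (sub z zA).
have ind a b : a \in s -> b \in s -> a != b -> index a s <> index b s.
  by move=> aS bS /eqP ab /(congr1 (nth a s)); rewrite !nth_index.
have := (ind _ _ xs ys xy); have := (ind _ _ ys zs yz); have := (ind _ _ zs xs zx).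
move: (cl x y xA yA xy) (cl y z yA zA yz); rewrite !mat // => /eqP + /eqP.
move: (index x s) (index y s) (index z s) => i j k ij jk.
have halfI a b : a./2 = b./2 -> odd a = odd b -> a = b.
  by move=> ab oab; rewrite -(odd_double_half a) -(odd_double_half b) ab oab.
move: (halfI _ _ ij) (halfI _ _ jk) (halfI k i (esym (etrans ij jk))).
by case: (odd i); case: (odd j); case: (odd k); intuition.
Qed.

(** Each vertex of [us] uses up the next four entries of [s]: two matching edges, which induce a
    [2K_2]. *)
Lemma clear_vertices us s V : uniq us -> uniq s -> (forall x, x \in us -> x \notin s) ->
  {subset s <= V} -> induced_matching s -> (4 * size us <= size s)%N -> ~~ edge_parity V ->
  exists W, [/\ reach V W, forall x, x \in us -> x \notin W &
    forall x, x \in V -> x \notin us -> x \notin s -> x \in W].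
Proof.
elim: us s V => [|u us IH] s V; first by move=> *; exists V; split=> //; apply: reach_refl.
case: s => [|x1 [|y1 [|x2 [|y2 s]]]]; try by rewrite mulnS /=; lia.
move=> /= /andP[uus unus] uns dis sub mat; rewrite mulnS ltnS /= => le eV.
set B := [:: x1; y1; x2; y2].
have uB : u \notin B.
  by have := dis u (mem_head _ _); rewrite !inE !negb_or; do 4![case/andP => -> /=].
have [unB unsB uns'] : [/\ uniq B, forall x, x \in s -> x \notin B & uniq s].
  move: (uns : uniq (B ++ s)); rewrite cat_uniq => /and3P[-> /hasPn h ->].
  by split.
have indB : forall x, x \in s -> index x (B ++ s) = (4 + index x s)%N.
  by move=> x /unsB xB; rewrite index_cat (negPf xB).
have matB x y : x \in B ++ s -> y \in B ++ s -> x != y ->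
  adj x y = ((index x (B ++ s))./2 == (index y (B ++ s))./2) := mat x y.
(* In these four facts [u] only serves as the default value of [nth]. *)
have i0 : index x1 (B ++ s) = 0 := @index_uniq _ u 0 (B ++ s) isT uns.
have i1 : index y1 (B ++ s) = 1 := @index_uniq _ u 1 (B ++ s) isT uns.
have i2 : index x2 (B ++ s) = 2 := @index_uniq _ u 2 (B ++ s) isT uns.
have i3 : index y2 (B ++ s) = 3 := @index_uniq _ u 3 (B ++ s) isT uns.
have neq x y : index x (B ++ s) != index y (B ++ s) -> x != y.
  by apply: contraNneq => ->.
have {}sub : {subset B ++ s <= V} := sub.
have BinV : {subset B <= V} by move=> x xB; apply: sub; rewrite mem_cat xB.
have [||||||W [rW uW sW]] := clearable_vertex V u x1 y1 x2 y2 _ _ _ _ _ _ eV; rewrite -/B //.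
- by rewrite cons_uniq uB.
- by rewrite matB ?i0 ?i1 ?neq ?i0 ?i1 // !inE eqxx ?orbT.
- by rewrite matB ?i2 ?i3 ?neq ?i2 ?i3 // !inE eqxx ?orbT.
- by rewrite matB ?i0 ?i2 ?neq ?i0 ?i2 // !inE eqxx ?orbT.
- by rewrite matB ?i1 ?i2 ?neq ?i1 ?i2 // !inE eqxx ?orbT.
have keepW x : x \in V -> x != u -> x \notin B -> x \in W.
  by move=> xV xu xB; apply: (subsetP sW); rewrite inE xV inE in_cons negb_or xu xB.
have us_s x : x \in us -> x \notin B ++ s by move=> xus; apply: dis; rewrite inE xus orbT.
have u_s : u \notin B ++ s by apply: dis; rewrite mem_head.
have [||||W' [rW' usW' sW']] := IH s W unus uns' _ _ _ _ (reach_even _ _ rW eV).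
- by move=> x /us_s; rewrite mem_cat negb_or => /andP[].
- move=> x xs; apply: keepW; rewrite ?unsB //.
    by apply: sub; rewrite mem_cat xs orbT.
  by apply: contraNneq u_s => <-; rewrite mem_cat xs orbT.
(* Dropping four entries shifts all halves by 2, so [s] is still an induced matching. *)
- move=> x y xs ys xy; rewrite matB ?mem_cat ?xs ?ys ?orbT // !indB // !halfD.
- by move: le; rewrite !ltnS.
exists W'; split.
- exact: reach_trans rW rW'.
- move=> x; rewrite inE => /orP[/eqP->|]; last exact: usW'.
  by apply: contra uW; apply: (subsetP (reach_sub _ _ rW')).
- move=> x xV; rewrite inE negb_or => /andP[xu xus].
  rewrite (_ : _ \notin _ = (x \notin B ++ s)) // mem_cat negb_or => /andP[xB xs].
  by apply: sW' => //; apply: keepW.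
Qed.

Definition clique_bounded A := forall C, C \subset A -> clique C -> (#|C| < 4)%N.

(* [A] is what remains of the enlarged matching under treatment, [L] the stock of uncovered vertices. *)
Lemma clear_all (Ms : seq (seq 'I_n)) A L V :
  (forall M, M \in Ms -> size M = 12 /\ induced_matching M) -> uniq (flatten Ms) ->
  clique_bounded A -> {subset flatten Ms <= V} ->
  (forall x, x \in V -> [|| x \in A, x \in L | x \in flatten Ms]) ->
  (forall x, x \in flatten Ms -> (x \notin A) && (x \notin L)) ->
  (#|L| <= size Ms)%N -> ~~ edge_parity V -> reach V set0.
Proof.
elim: Ms A L V => [|M Ms IH] A L V good un bdA sub cov dis leL eV.
  have VA : V \subset A.
    (* With no matching left the stock [L] is empty, so all of [V] lies in [A]. *)
    apply/subsetP => x /cov; rewrite orbF => /orP[//|].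
    by move: leL; rewrite leqn0 cards_eq0 => /eqP->; rewrite inE.
  have [W [rW _ cW]] := reach_clique _ A eV.
  have WA : W \subset A := subset_trans (reach_sub _ _ rW) VA.
  move: cW; rewrite (setIidPl WA) => cW.
  apply: (reach_trans _ _ _ rW); apply: clique_reach0 => //; last exact: bdA.
  exact: reach_even rW eV.
move: un; rewrite /= cat_uniq => /and3P[uM dMs uMs].
have {}dis x : x \in M ++ flatten Ms -> x \notin A /\ x \notin L by move/dis/andP.
have [M12 matM] := good M (mem_head _ _).
have [W [rW sW cW]] := reach_clique _ A eV.
have W3 : (#|W :&: A| < 4)%N by apply: bdA; rewrite // subsetIr.
have keepW x : x \in M ++ flatten Ms -> x \in W.
  move=> xM; apply: (subsetP sW); rewrite inE (sub x xM) andbT.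
  by have [] := dis x xM.
have [|||W' [rW' AW' sW']] := clear_vertices (enum (W :&: A)) M W (enum_uniq _) uM
   _ _ matM _ (reach_even _ _ rW eV).
- move=> x; rewrite mem_enum inE => /andP[_ xA]; apply/negP => xM.
  by have [/negP[]] : x \notin A /\ x \notin L by apply: dis; rewrite mem_cat xM.
- by move=> x xM; apply: keepW; rewrite mem_cat xM.
(* The clique left in [A] has at most 3 vertices, and each takes 4 of the 12 entries of [M]. *)
- by rewrite -cardE M12 -[12]/(4 * 3) leq_pmul2l.
apply: (reach_trans _ _ _ rW (reach_trans _ _ _ rW' _)).
(* One stock vertex, if there is any, joins [M], so the stock shrinks along with the list of
   matchings. *)
have [X [XL X1 LX]] : exists X, [/\ X \subset L, (#|X| <= 1)%N & (#|L :\: X| <= size Ms)%N].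
  have [->|[l lL]] := set_0Vmem L.
    by exists set0; rewrite sub0set setD0 cards0.
  exists [set l]; rewrite sub1set lL cards1; split=> //.
  by move: leL; rewrite (cardsD1 l) lL.
have WV x : x \in W' -> x \in V.
  by move/(subsetP (reach_sub _ _ rW'))/(subsetP (reach_sub _ _ rW)).
(* The new [A] may include vertices of [M] that are already deleted; it only has to cover what
   remains. *)
apply: (IH ([set x in M] :|: X) (L :\: X)) => //.
- by move=> N NMs; apply: good; rewrite inE NMs orbT.
(* A clique has at most 2 vertices in the matching and at most 1 in [X]. *)
- move=> C /subsetP CMX cC; have CX : {subset C :\: X <= M}.
    by move=> x; rewrite inE => /andP[xX /CMX]; rewrite !inE (negPf xX) orbF.
  have := induced_matching_clique _ _ matM CX (cliqueS _ _ (subsetDl _ _) cC).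
  rewrite -(cardsID X C); have := subset_leq_card (subsetIr C X).
  by move: X1; lia.
- move=> x xMs; apply: sW'.
  + by apply: keepW; rewrite mem_cat xMs orbT.
  + rewrite mem_enum inE negb_and; apply/orP; right.
    by have [] : x \notin A /\ x \notin L by apply: dis; rewrite mem_cat xMs orbT.
  + by apply: contraL xMs => xM; apply: contra dMs => xMs; apply/hasP; exists x.
- move=> x xW'; have := cov x (WV x xW'); rewrite /= mem_cat !inE.
  case xX: (x \in X) => /=; first by rewrite orbT.
  case xA: (x \in A) => /=; last by case: (x \in L); case: (x \in M).
  case: (boolP (x \in W)) => [xW|xW]; last first.
    by case/negP: xW; apply: (subsetP (reach_sub _ _ rW')).
  by have /negP[] : x \notin W' by apply: AW'; rewrite mem_enum inE xW.
- move=> x xMs; have [xA xL] : x \notin A /\ x \notin L by apply: dis; rewrite mem_cat xMs orbT.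
  rewrite !inE (negPf xL) andbF andbT orbC (contraNF (subsetP XL x)) //=.
  by apply: contra dMs => xM; apply/hasP; exists x.
- exact: reach_even rW' (reach_even _ _ rW eV).
Qed.

(** Twelve vertices carry six edges, hence three copies of [2K_2]: one for each vertex of a clique
    of size at most 3. *)
Definition has_matching S := exists M : seq 'I_n,
  [/\ uniq M, size M = 12, {subset M <= S} & induced_matching M].

(** Greedy: matchings are split off while at least [s] vertices remain. *)
Lemma matching_cover s S : (forall S', (s <= #|S'|)%N -> has_matching S') ->
  exists Ms, [/\ forall M, M \in Ms -> size M = 12 /\ induced_matching M,
    uniq (flatten Ms), {subset flatten Ms <= S} & (#|S :\: [set x in flatten Ms]| < s)%N].
Proof.
move=> H; have [m] := ubnP #|S|; elim: m S => // m IH S lt.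
have [Ss|sS] := ltnP #|S| s.
  by exists [::]; split=> //; rewrite (_ : [set x in _] = set0) ?setD0 //; apply/setP => x; rewrite !inE.
have [M [uM M12 MS mM]] := H S sS.
have [|Ms [good uMs sMs rest]] := IH (S :\: [set x in M]).
  have : [set x in M] \subset S by apply/subsetP => x; rewrite inE; apply: MS.
  move/setIidPr => SM; have := cardsID [set x in M] S; rewrite SM cardsE (card_uniqP uM) M12 => card_S.
  by move: lt; rewrite -card_S ltnS; apply: leq_trans; rewrite -add1n leq_add2r.
exists (M :: Ms); split=> /=.
- by move=> N; rewrite inE => /orP[/eqP->|/good].
- rewrite cat_uniq uM uMs andbT; apply/hasPn => x /sMs.
  by rewrite !inE => /andP[].
- by move=> x; rewrite mem_cat => /orP[/MS//|/sMs]; rewrite inE => /andP[].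
- apply: leq_ltn_trans rest; apply: subset_leq_card; apply/subsetP => x.
  by rewrite !inE mem_cat negb_or => /andP[/andP[-> ->] ->].
Qed.

Lemma matchings_decomposable s : (13 * s <= n)%N ->
  (forall S, (s <= #|S|)%N -> has_matching S) -> ~~ odd #|E| -> even_decomposable E.
Proof.
move=> sn H evE; apply: reach_decomposable => //.
have [Ms [good uMs _ rest]] := matching_cover s setT H.
have F12 : size (flatten Ms) = (12 * size Ms)%N.
  elim: Ms good {uMs rest} => [|M Ms IH] good; first by rewrite muln0.
  rewrite /= size_cat IH; last by move=> N NMs; apply: good; rewrite inE NMs orbT.
  by have [-> _] := good M (mem_head _ _); rewrite mulnS.
apply: (clear_all Ms set0 (~: [set x in flatten Ms])) => //.
- by move=> C; rewrite subset0 => /eqP->; rewrite cards0.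
- by move=> x _; rewrite inE.
- by move=> x _; rewrite !inE; case: (x \in flatten Ms).
- by move=> x xMs; rewrite !inE xMs.
(* With [L] the uncovered set, [12 * size Ms + #|L| = n >= 13 * s] and [#|L| < s] give
   [size Ms > s > #|L|]. *)
- move: rest; rewrite setTD; have := cardsC [set x in flatten Ms].
  rewrite cardsE (card_uniqP uMs) F12 card_ord.
  move: sn (size Ms) #|_| => sn a b. lia.
- rewrite /edge_parity /induced_edges.
  by rewrite (_ : [set e in E | _] = E) //; apply/setP => e; rewrite !inE subsetT andbT.
Qed.

End Decomposition.

Local Open Scope ring_scope.

(** * Random subsets of a finite set with independent elements *)

Section RandomSubset.
Variables (R : realFieldType) (T : finType) (p : R).
Hypotheses (p_ge0 : 0 <= p) (p_le1 : p <= 1).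
Implicit Types (A B D X Y Z : {set T}) (P Q : pred {set T}).

(** The ground set [D] stays a parameter, so that the measure can be split along disjoint blocks. *)
Definition weight D X := p ^+ #|X| * (1 - p) ^+ (#|D| - #|X|).
Definition prob D P := \sum_(X : {set T} | (X \subset D) && P X) weight D X.

Lemma weight_ge0 D X : 0 <= weight D X.
Proof. by rewrite mulr_ge0 ?exprn_ge0 // subr_ge0. Qed.

Lemma prob_ge0 D P : 0 <= prob D P.
Proof. by apply: sumr_ge0 => X _; apply: weight_ge0. Qed.

(** Grouping subsets by size turns the sum into the binomial expansion of [(1 - p + p) ^+ #|D|]. *)
Lemma prob_setT D : prob D xpredT = 1.
Proof.
rewrite /prob.
have -> : 1 = (1 - p + p) ^+ #|D| by rewrite subrK expr1n.
rewrite exprDn (partition_big (fun X => inord #|X| : 'I_#|D|.+1) xpredT) //=.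
apply: eq_bigr => k _.
rewrite -cards_draws -sumr_const; apply: eq_big => X.
  rewrite !inE andbT; case: (boolP (X \subset D)) => //= XD.
  by rewrite -val_eqE /= inordK // ltnS subset_leq_card.
move=> /andP[/andP[XD _] /eqP <-]; rewrite inordK ?ltnS ?subset_leq_card //.
by rewrite /weight mulrC.
Qed.

(** Independence of the traces on disjoint sets: [X] corresponds to the pair [(X :&: A, X :&: B)],
    and weights multiply. *)
Lemma probU A B P Q : [disjoint A & B] ->
  prob (A :|: B) (fun X => P (X :&: A) && Q (X :&: B)) = prob A P * prob B Q.
Proof.
move=> dAB; rewrite /prob big_distrlr /= pair_big /=.
have UA Y Z : Y \subset A -> Z \subset B -> (Y :|: Z) :&: A = Y.
  move=> YA ZB; rewrite setIUl (setIidPl YA); apply/setUidPl.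
  by rewrite (_ : Z :&: A = set0) ?sub0set //; apply/disjoint_setI0;
     rewrite disjoint_sym; apply: disjointWr dAB.
have UB Y Z : Y \subset A -> Z \subset B -> (Y :|: Z) :&: B = Z.
  move=> YA ZB; rewrite setIUl (setIidPl ZB); apply/setUidPr.
  by rewrite (_ : Y :&: B = set0) ?sub0set //; apply/disjoint_setI0; apply: disjointWl dAB.
rewrite (reindex_onto (fun YZ : {set T} * {set T} => YZ.1 :|: YZ.2)
  (fun X => (X :&: A, X :&: B))) /=; last first.
  by move=> X /andP[XAB _]; rewrite -setIUr; apply/setIidPl.
apply: eq_big => [[Y Z]|[Y Z]] /=.
  apply/idP/idP; last first.
    by case/andP=> /andP[YA PY] /andP[ZB QZ]; rewrite setUSS // UA // UB // PY QZ eqxx.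
  case/andP=> /andP[_ /andP[PY QZ]] /eqP[Y1 Z1]; move: PY QZ; rewrite Y1 Z1 => -> ->.
  by rewrite -Y1 -Z1 !subsetIr.
case/andP=> _ /eqP[Y1 Z1].
have YA : Y \subset A by rewrite -Y1 subsetIr.
have ZB : Z \subset B by rewrite -Z1 subsetIr.
have dYZ : [disjoint Y & Z] by apply: disjointWl YA _; apply: disjointWr dAB.
rewrite /weight !cardsU !disjoint_setI0 // cards0 !subn0.
have := subset_leq_card YA; have := subset_leq_card ZB => cz cy.
rewrite (_ : (#|A| + #|B| - _ = (#|A| - #|Y|) + (#|B| - #|Z|))%N); last first.
  by rewrite subnDA addnC -addnBA // addnC addnBA.
by rewrite !exprD mulrACA.
Qed.

Lemma eq_prob D P Q : (forall X, X \subset D -> P X = Q X) -> prob D P = prob D Q.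
Proof. by move=> PQ; apply: eq_bigl => X; apply: andb_id2l => /PQ. Qed.

Lemma le_prob D P Q : (forall X, X \subset D -> P X -> Q X) -> prob D P <= prob D Q.
Proof.
move=> PQ; rewrite /prob [leRHS](bigID P) /=; apply: ler_wpDr.
  by apply: sumr_ge0 => X _; apply: weight_ge0.
rewrite le_eqVlt; apply/orP; left; apply/eqP; apply: eq_bigl => X.
case XD: (X \subset D) => //=; case PX: (P X); rewrite ?andbF ?andbT //.
by rewrite PQ.
Qed.

Lemma prob_neq D Y : Y \subset D -> prob D (fun X => X != Y) = 1 - weight D Y.
Proof.
move=> YD; have := prob_setT D; rewrite {1}/prob (bigD1 Y) ?YD //=.
move/(canRL (addKr _)); rewrite addrC => <-.
by apply: eq_bigl => X; rewrite andbT.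
Qed.

Lemma weight_lb D Y r : 0 <= r -> r <= p -> r <= 1 - p -> Y \subset D ->
  r ^+ #|D| <= weight D Y.
Proof.
move=> r0 rp rp1 YD; rewrite /weight -{1}(subnKC (subset_leq_card YD)) exprD.
by apply: ler_pM; rewrite ?exprn_ge0 // lerXn2r // nnegrE // subr_ge0.
Qed.

(** The traces on the disjoint blocks [Q i] are independent, and each misses its pattern [F i] with
    probability at most [1 - q]. *)
Lemma prob_avoid (I : eqType) (ss : seq I) (Q F : I -> {set T}) (q : R) D :
  uniq ss -> {in ss, forall i, Q i \subset D} -> {in ss, forall i, F i \subset Q i} ->
  {in ss &, forall i j, i != j -> [disjoint Q i & Q j]} ->
  {in ss, forall i, q <= weight (Q i) (F i)} -> q <= 1 ->
  prob D (fun X => all (fun i => X :&: Q i != F i) ss) <= (1 - q) ^+ size ss.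
Proof.
elim: ss D => [|i ss IH] D /=; first by move=> *; rewrite prob_setT.
move=> /andP[iss uss] sQ sF dQ wq q1.
have ii : i \in i :: ss by rewrite mem_head.
have ss_i j : j \in ss -> j \in i :: ss by move=> h; rewrite inE h orbT.
have dis : [disjoint Q i & D :\: Q i].
  by rewrite -setI_eq0 setIDA setIC setDIl setDv setI0.
have QD j : j \in ss -> Q j \subset D :\: Q i.
  move=> js; rewrite subsetD (sQ j (ss_i j js)) (dQ j i (ss_i j js) ii) //.
  by apply: contraNneq iss => <-.
have -> : prob D (fun X => (X :&: Q i != F i) && all (fun j => X :&: Q j != F j) ss) =
  prob (Q i) (fun Y => Y != F i) *
  prob (D :\: Q i) (fun Y => all (fun j => Y :&: Q j != F j) ss).
  rewrite -probU // -{2}(setIidPr (sQ i ii)) setID.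
  apply: eq_prob => X XD; congr (_ && _); apply: eq_in_all => j js.
  by rewrite -setIA (setIidPr (QD j js)).
rewrite exprS; apply: ler_pM; rewrite ?prob_ge0 //.
  by rewrite prob_neq ?sF // lerB // wq.
apply: IH => //.
- by move=> j js; apply: sF; apply: ss_i.
- by move=> j k js ks; apply: dQ; apply: ss_i.
- by move=> j js; apply: wq; apply: ss_i.
Qed.

(** The union bound. *)
Lemma prob_exists (I : finType) D (B : I -> pred {set T}) (q : R) :
  (forall i, prob D (B i) <= q) ->
  prob D (fun X => [exists i, B i X]) <= q *+ #|I|.
Proof.
move=> Bq; rewrite -sumr_const; apply: le_trans (ler_sum _ (fun i _ => Bq i)).
rewrite /prob; under [leRHS]eq_bigr => i _ do rewrite big_mkcondr.
rewrite exchange_big /= big_mkcondr; apply: ler_sum => X XD.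
have [/existsP[i Bi]|_] := boolP [exists i, B i X]; last first.
  by apply: sumr_ge0 => i _; case: ifP => // _; apply: weight_ge0.
rewrite (bigD1 i) //= Bi ler_wpDr // sumr_ge0 // => j _; case: ifP => // _.
exact: weight_ge0.
Qed.

End RandomSubset.

(** * The matching event along a fixed list *)

Section MatchingEvent.
Variables (n : nat) (M : seq 'I_n).
Implicit Types (x y : 'I_n) (E : {set {set 'I_n}}).

Definition seq_pairs : {set {set 'I_n}} :=
  [set e : {set 'I_n} | (e \subset [set x in M]) && (#|e| == 2)].

Definition seq_matching : {set {set 'I_n}} :=
  [set e in seq_pairs | [exists x, exists y,
     (e == [set x; y]) && ((index x M)./2 == (index y M)./2)]].

Lemma mem_seq_pairs x y : x != y ->
  ([set x; y] \in seq_pairs) = (x \in M) && (y \in M).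
Proof. by move=> xy; rewrite inE cards2 xy subUset !sub1set !inE andbT. Qed.

Lemma seq_pairs_sub : seq_pairs \subset pairs n.
Proof. by apply/subsetP => e; rewrite !inE => /andP[]. Qed.

Lemma seq_matching_sub : seq_matching \subset seq_pairs.
Proof. by apply/subsetP => e; rewrite inE => /andP[]. Qed.

Lemma card_seq_pairs : uniq M -> #|seq_pairs| = 'C(size M, 2).
Proof. by move=> uM; rewrite cards_draws cardsE (card_uniqP uM). Qed.

(** Expresses the matching as one prescribed trace on the pairs inside [M], the form [prob_avoid]
    works with. *)
Lemma induced_matchingI E : E :&: seq_pairs = seq_matching -> induced_matching n E M.
Proof.
move=> EQ x y xM yM xy; rewrite /adj.
have xyQ : [set x; y] \in seq_pairs by rewrite mem_seq_pairs // xM yM.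
have -> : ([set x; y] \in E) = ([set x; y] \in seq_matching) by rewrite -EQ inE xyQ andbT.
rewrite inE xyQ /=; apply/existsP/idP => [[x' /existsP[y' /andP[/eqP e h]]]|h].
  have : x \in [set x'; y'] by rewrite -e !inE eqxx.
  have : y \in [set x'; y'] by rewrite -e !inE eqxx orbT.
  rewrite !inE => /orP[]/eqP ey /orP[]/eqP ex; move: xy; rewrite ex ey ?eqxx //.
  by rewrite (eqP h).
by exists x; apply/existsP; exists y; rewrite eqxx.
Qed.

End MatchingEvent.

(** * Packing 12-subsets that pairwise share at most one vertex *)

Section Slots.
Variables (n N : nat) (S : {set 'I_n}).
Hypothesis leNS : (144 * N <= #|S|)%N.
Local Open Scope nat_scope.

(* The slot [t = (a, b)] is the line [i |-> (i, a + i b)] of a grid with 12 columns of height [12 N]. *)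
Definition slot_pos (t : 'I_N * 'I_N) (i : nat) := i * (12 * N) + (t.1 + i * t.2).

(** The offset is at most [(N - 1) + 11 * (N - 1)], which explains the column height. *)
Lemma slot_offset_lt (t : 'I_N * 'I_N) i : i < 12 -> t.1 + i * t.2 < 12 * N.
Proof.
move=> i12; have := ltn_ord t.1; have := ltn_ord t.2 => h2 h1.
have : i * t.2 <= 11 * t.2 by rewrite leq_mul2r -ltnS i12 orbT.
by move: h1 h2; lia.
Qed.

Lemma slot_pos_lt t i : i < 12 -> slot_pos t i < #|S|.
Proof.
move=> i12; apply: leq_trans leNS; have := slot_offset_lt t i i12.
have : i * (12 * N) <= 11 * (12 * N) by rewrite leq_mul2r -ltnS i12 orbT.
by rewrite /slot_pos; lia.
Qed.

(** Division by [12 * N] recovers the column, and the remainder is the height in it. *)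
Lemma slot_pos_eq t t' i i' : i < 12 -> i' < 12 -> slot_pos t i = slot_pos t' i' ->
  i = i' /\ t.1 + i * t.2 = t'.1 + i * t'.2.
Proof.
move=> i12 i'12; have lt := slot_offset_lt t i i12; have lt' := slot_offset_lt t' i' i'12.
have N0 : 0 < 12 * N by apply: leq_trans lt.
rewrite /slot_pos => e; have ii' : i = i'.
  have := congr1 (divn^~ (12 * N)) e.
  by rewrite /= !divnMDl // !divn_small // !addn0.
by split=> //; move: e; rewrite ii' => /addnI.
Qed.

(** Two lines that meet in two columns coincide: subtracting the equations gives equal slopes. *)
Lemma slot_lines (t t' : 'I_N * 'I_N) i j : i != j ->
  t.1 + i * t.2 = t'.1 + i * t'.2 -> t.1 + j * t.2 = t'.1 + j * t'.2 -> t = t'.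
Proof.
wlog ij : i j / i < j.
  by move=> H; rewrite neq_ltn => /orP[] ij ei ej; [apply: (H i j)|apply: (H j i)];
     rewrite // ltn_eqF.
case: t t' => [a b] [a' b'] /= _ ei ej.
have eb : b = b' :> nat.
  apply/eqP; rewrite -(@eqn_pmul2l (j - i)) ?subn_gt0 //; apply/eqP.
  by move: ei ej; rewrite -{1 2}(subnKC (ltnW ij)) !mulnDl; lia.
have ea : a = a' :> nat by move: ei; rewrite eb; apply: addIn.
by rewrite (ord_inj ea) (ord_inj eb).
Qed.

Variable x0 : 'I_n.
Definition slot_vertex t i := nth x0 (enum S) (slot_pos t i).
Definition slot t := [seq slot_vertex t i | i <- iota 0 12].

Lemma slot_vertex_eq t t' i i' : i < 12 -> i' < 12 ->
  slot_vertex t i = slot_vertex t' i' -> slot_pos t i = slot_pos t' i'.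
Proof.
move=> i12 i'12 /eqP; rewrite nth_uniq ?enum_uniq -?cardE ?slot_pos_lt //.
by move/eqP.
Qed.

Lemma slotP t x : reflect (exists2 i, i < 12 & x = slot_vertex t i) (x \in slot t).
Proof.
by apply: (iffP mapP) => -[i]; rewrite ?mem_iota => i12 ->; exists i; rewrite ?mem_iota.
Qed.

Lemma slot_uniq t : uniq (slot t).
Proof.
rewrite map_inj_in_uniq ?iota_uniq // => i j; rewrite !mem_iota /= => i12 j12.
by move/slot_vertex_eq => /(_ i12 j12)/slot_pos_eq => /(_ i12 j12)[].
Qed.

Lemma slot_sub t : {subset slot t <= S}.
Proof.
by move=> x /slotP[i i12 ->]; rewrite -mem_enum mem_nth // -cardE slot_pos_lt.
Qed.

Lemma slot_pairs_disjoint t t' : t != t' -> [disjoint seq_pairs n (slot t) & seq_pairs n (slot t')].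
Proof.
apply: contraNT => /pred0Pn[e] /andP[/= et et'].
have /cards2P[x [y [xy exy]]] : #|e| == 2.
  by move: (subsetP (seq_pairs_sub n (slot t)) e et); rewrite in_set.
move: et et'; rewrite exy !mem_seq_pairs // => /andP[xt yt] /andP[xt' yt'].
have [[i i12 xi] [j j12 yj]] := (slotP t x xt, slotP t y yt).
have [[i' i12' xi'] [j' j12' yj']] := (slotP t' x xt', slotP t' y yt').
have ij : i != j by apply: contraNneq xy => e'; rewrite xi yj e'.
have [_ ei] := slot_pos_eq _ _ _ _ i12 i12' (slot_vertex_eq _ _ _ _ i12 i12' (etrans (esym xi) xi')).
have [_ ej] := slot_pos_eq _ _ _ _ j12 j12' (slot_vertex_eq _ _ _ _ j12 j12' (etrans (esym yj) yj')).
by rewrite (slot_lines t t' i j ij ei ej).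
Qed.

End Slots.

(** * Probability that large sets lack a matching *)

Section MatchingProbability.
Variables (R : realFieldType) (n : nat) (p r : R).
Hypotheses (r_ge0 : 0 <= r) (r_le_p : r <= p) (r_le_p' : r <= 1 - p).

Let p_ge0 : 0 <= p. Proof. exact: le_trans r_le_p. Qed.
Let p_le1 : p <= 1. Proof. by rewrite -subr_ge0; apply: le_trans r_le_p'. Qed.
Let r_le1 : r <= 1. Proof. exact: le_trans r_le_p p_le1. Qed.

Lemma prob_no_matching N (S : {set 'I_n}) : (144 * N <= #|S|)%N ->
  prob _ _ p (pairs n) (fun E => ~~ `[< has_matching n E S >]) <= (1 - r ^+ 66) ^+ (N ^ 2).
Proof.
(* For [N = 0] the bound is 1; otherwise [S] is nonempty and provides a default vertex. *)
move=> leNS; have [->|N0] := posnP N; first by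
  rewrite expr0 -(prob_setT _ _ p (pairs n)) le_prob.
have [x0 _] : exists x0, x0 \in S.
  by apply/card_gt0P; apply: leq_trans leNS; rewrite muln_gt0.
have -> : (N ^ 2)%N = size (enum {: 'I_N * 'I_N}).
  by rewrite -cardE card_prod card_ord mulnn.
apply: le_trans (prob_avoid _ _ p p_ge0 p_le1 _ _ (fun t => seq_pairs n (slot n N S x0 t)) (fun t => seq_matching n (slot n N S x0 t))
  (r ^+ 66) (pairs n) _ _ _ _ _ _).
- apply: le_prob => // E _; apply: contraNT => /allPn[t _]; rewrite negbK => /eqP EQ.
  apply/asboolP; exists (slot n N S x0 t); split; last exact: induced_matchingI.
  - exact: slot_uniq.
  - by rewrite size_map size_iota.
  - exact: slot_sub.
- exact: enum_uniq.
- by move=> t _; apply: seq_pairs_sub.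
- by move=> t _; apply: seq_matching_sub.
- by move=> t t' _ _; apply: slot_pairs_disjoint.
(* 66 is the number of pairs among 12 vertices. *)
- move=> t _; have <- : #|seq_pairs n (slot n N S x0 t)| = 66%N.
    by rewrite card_seq_pairs ?slot_uniq // size_map size_iota.
  apply: weight_lb => //.
  exact: seq_matching_sub.
- exact: exprn_ile1.
Qed.

Lemma prob_even_non_decomposable N : (13 * (144 * N) <= n)%N ->
  prob _ _ p (pairs n) (fun E => `[< even_non_decomposable E >]) <=
  (1 - r ^+ 66) ^+ (N ^ 2) *+ 2 ^ n.
Proof.
move=> leNn; have -> : (2 ^ n = #|{set 'I_n}|)%N by rewrite -cardsT -powersetT card_powerset cardsT card_ord.
(* The size condition is put into the event, so the union bound can run over all [2 ^ n] subsets;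
   for small [S] the event is empty. *)
have bad (S : {set 'I_n}) : prob _ _ p (pairs n) (fun E => (144 * N <= #|S|)%N && ~~ `[< has_matching n E S >])
    <= (1 - r ^+ 66) ^+ (N ^ 2).
  have [leNS|ltSN] := leqP (144 * N) #|S|; first exact: prob_no_matching.
  rewrite /prob big_pred0 ?exprn_ge0 ?subr_ge0 ?exprn_ile1 // => E.
  by rewrite andbF.
apply: le_trans (prob_exists _ _ p p_ge0 p_le1 _ _ _ _ bad).
apply: le_prob => // E gE /asboolP[evE ndE]; apply/existsP; apply: contrapT => nex.
apply: ndE; apply: (matchings_decomposable n E gE (144 * N)) => // S leNS.
apply: contrapT => nM; apply: nex; exists S; rewrite leNS; exact/asboolP.
Qed.

End MatchingProbability.

(** * From the union bound to the exponential form *)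

Lemma le1D_exp (x : Rdefinitions.R) : 1 + x <= Rtrigo_def.exp x.
Proof. exact/RleP/Rpower.exp_ineq1_le. Qed.

Lemma expXn (x : Rdefinitions.R) k : Rtrigo_def.exp x ^+ k = Rtrigo_def.exp (x * k%:R).
Proof.
elim: k => [|k IH]; first by rewrite expr0 mulr0 Rtrigo_def.exp_0.
by rewrite exprSr IH -natr1 mulrDr mulr1 [RHS]Exp_prop.exp_plus.
Qed.

Lemma union_bound_le_exp (q : Rdefinitions.R) (K : nat) : 0 < q -> q <= 1 -> (0 < K)%N ->
  exists (c : Rdefinitions.R) (n0 : nat), 0 < c /\ forall n, (n0 <= n)%N ->
    (1 - q) ^+ ((n %/ K) ^ 2) *+ 2 ^ n <= Rtrigo_def.exp (- (c * n%:R ^+ 2)).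
Proof.
move=> q0 q1 K0; have K0R : 0 < K%:R :> Rdefinitions.R by rewrite ltr0n.
(* With [N = n %/ K] and [n <= 2 * K * N], this gives [q * N ^ 2 >= 2 * c * n ^ 2]; half of that
   absorbs the factor [2 ^ n]. *)
set c := q / (8%:R * K%:R ^+ 2).
have c0 : 0 < c by rewrite divr_gt0 // mulr_gt0 // exprn_gt0.
(* The first bound yields [n <= 2 * K * N], the second [1 <= c * n] and hence [n <= c * n ^ 2]. *)
exists c, (maxn (2 * K) (Num.bound c^-1)); split=> // n; rewrite geq_max => /andP[nK nc].
set N := (n %/ K)%N.
have exp_gt0 x : 0 < Rtrigo_def.exp x by apply/RltP/Exp_prop.exp_pos.
have n2N : n%:R <= (2 * K%:R) * N%:R :> Rdefinitions.R.
  rewrite -!natrM ler_nat; have := divn_eq n K; have := ltn_pmod n K0; rewrite -/N.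
  have : (2 <= N)%N by rewrite leq_divRL.
  move: N => N N2 m e; rewrite e; nia.
have cn1 : 1 <= c * n%:R.
  have : c^-1 <= n%:R.
    apply: le_trans (_ : (Num.bound c^-1)%:R <= _); last by rewrite ler_nat.
    by apply: ltW; apply: archi_boundP; rewrite invr_ge0 ltW.
  by rewrite -[1](divff (lt0r_neq0 c0)) ler_pM2l.
apply: (@le_trans _ _ (Rtrigo_def.exp (- q) ^+ (N ^ 2) * Rtrigo_def.exp 1 ^+ n)).
  rewrite -mulr_natr natrX; apply: ler_pM; rewrite ?exprn_ge0 ?subr_ge0 //.
    by rewrite lerXn2r ?nnegrE ?subr_ge0 ?(ltW (exp_gt0 _)) // le1D_exp.
  by rewrite lerXn2r ?nnegrE ?(ltW (exp_gt0 _)) // (natrD _ 1 1) le1D_exp.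
have mono x y : x <= y -> Rtrigo_def.exp x <= Rtrigo_def.exp y.
  rewrite le_eqVlt => /orP[/eqP->//|/RltP xy]; apply/ltW/RltP; exact: Rpower.exp_increasing.
rewrite !expXn -[X in X <= _]Exp_prop.exp_plus; apply: mono.
rewrite -[Rdefinitions.Rplus _ _]/(- q * (N ^ 2)%:R + 1 * n%:R) natrX mul1r.
have -> : q = c * (8%:R * K%:R ^+ 2) by rewrite /c divfK // gt_eqF // mulr_gt0 // exprn_gt0.
have : n%:R ^+ 2 <= (2 * K%:R * N%:R) ^+ 2 :> Rdefinitions.R.
  by rewrite lerXn2r // nnegrE ?ler0n // !mulr_ge0 ?ler0n.
have nn : n%:R <= c * n%:R ^+ 2.
  by rewrite expr2 mulrA -[X in X <= _]mul1r ler_wpM2r.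
rewrite -(ler_pM2l c0); move: nn; lra.
Qed.

Theorem mainTheorem1 :
  exists (c : Rdefinitions.R) (n0 : nat), 0 < c /\
    forall (n : nat) (p : Rdefinitions.R), (n0 <= n)%N ->
      10 ^- 6 <= p -> p <= 1 - 10 ^- 6 ->
      Gnp_prob p (@even_non_decomposable n) <= Rtrigo_def.exp (- (c * (n%:R) ^+ 2)).
Proof.
have : 0 < (10 ^- 6 : Rdefinitions.R) /\ (10 ^- 6 : Rdefinitions.R) <= 1.
  by rewrite invr_gt0 exprn_gt0 // invf_le1 ?exprn_gt0 // exprn_ege1 // ler1n.
move: (10 ^- 6 : Rdefinitions.R) => r [r0 r1].
(* With [K = 13 * 144], the choice [N = n %/ K] satisfies [13 * (144 * N) <= n]. *)
have [|||c [n0 [c0 bound]]] := union_bound_le_exp (r ^+ 66) (13 * 144) _ _ _.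
- exact: exprn_gt0.
- by rewrite exprn_ile1 // ltW.
- by rewrite muln_gt0.
exists c, n0; split=> // n p n0n rp pr.
apply: le_trans (bound n n0n).
have rp' : r <= 1 - p by rewrite lerBrDr -lerBrDl.
(* [Gnp_prob] unfolds to [prob] with ground set [pairs n]. *)
apply: (prob_even_non_decomposable _ n p r (ltW r0) rp rp').
by rewrite mulnA mulnC leq_divM.
Qed.
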